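(* Let $K$ be a real quadratic field, a complex cubic field (cubic with exactly one real embedding), or a totally complex quartic field; in the last case assume that the only roots of unity in $K$ are $\pm 1$. Suppose that $K$ has a fundamental unit which is even. Then all units of $K$ are even. In particular, $\mathrm{od}(K)=\infty$.
   Context: In each of these cases the unit group of the ring of integers of $K$ has rank one; a fundamental unit is a unit generating the unit group modulo its torsion subgroup. For an integer polynomial $g(x)=b_nx^n+\dots+b_0$, its length is $L(g)=|b_n|+\dots+|b_0|$. An algebraic integer $\alpha$ is called even if $L(f)$ is even, where $f$ is the minimal monic polynomial of $\alpha$ over $\mathbb{Q}$, and odd otherwise. $\mathrm{od}(K)$ is the smallest odd $k\geq 3$ such that there exist units $\varepsilon_1,\dots,\varepsilon_k$ of $K$ with $\varepsilon_1+\dots+\varepsilon_k=0$, and $\infty$ if none exists. *)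

(* Defs.v *)
From HB Require Import structures.
From mathcomp Require Import all_boot all_order all_algebra all_field.
From mathcomp Require Import boolp constructive_ereal.

Set Implicit Arguments.
Unset Strict Implicit.
Unset Printing Implicit Defensive.

Import Order.TTheory GRing.Theory Num.Theory.
Local Open Scope ring_scope.

(* A number field is a [K : fieldExtType rat]. Its complex embeddings are the
   ring morphisms to [algC], since they only take algebraic values. *)
Section NumberFields.
Variable K : fieldExtType rat.

Definition real_embedding (sigma : {rmorphism K -> algC}) : Prop :=
  forall x : K, sigma x \is Num.real.

Definition real_quadratic : Prop :=
  \dim {:K} = 2%N /\
  exists sigma : {rmorphism K -> algC}, real_embedding sigma.

(* Embeddings are compared pointwise. *)
Definition complex_cubic : Prop :=
  \dim {:K} = 3%N /\
  exists2 sigma : {rmorphism K -> algC}, real_embedding sigma &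
    forall tau : {rmorphism K -> algC}, real_embedding tau -> tau =1 sigma.

Definition totally_complex_quartic : Prop :=
  \dim {:K} = 4%N /\
  forall sigma : {rmorphism K -> algC}, ~ real_embedding sigma.

Definition is_root_of_unity (z : K) : Prop :=
  exists2 m : nat, (0 < m)%N & z ^+ m = 1.

Definition algebraic_integer (x : K) : Prop :=
  integralOver (intr : int -> K) x.

Definition int_unit (u : K) : Prop :=
  algebraic_integer u /\ exists2 v : K, algebraic_integer v & u * v = 1.

Definition fundamental_unit (e : K) : Prop :=
  int_unit e /\
  forall u : K, int_unit u ->
    exists (z : K) (n : int), is_root_of_unity z /\ u = z * e ^ n.

Definition poly_length (g : {poly int}) : nat :=
  (\sum_(i < size g) absz (g`_i)%R)%N.

(* For an algebraic integer the minimal polynomial over the rationals has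
   integer coefficients, so that [f] exists; it is unique since [intr] is
   injective. *)
Definition even_integer (x : K) : Prop :=
  algebraic_integer x /\
  exists2 f : {poly int},
    map_poly (intr : int -> K) f = minPoly 1%AS x & ~~ odd (poly_length f).

Definition vanishing_unit_sum (k : nat) : Prop :=
  exists2 e : 'I_k -> K, (forall i, int_unit (e i)) & \sum_(i < k) e i = 0.

Definition od_candidate (k : nat) : bool :=
  [&& odd k, (3 <= k)%N & `[< vanishing_unit_sum k >]].

Definition od : \bar nat :=
  if pselect (exists k, od_candidate k) is left h then EFin (ex_minn h)
  else +oo%E.

End NumberFields.

(* Main.v *)
Require Import Defs.
From HB Require Import structures.
From mathcomp Require Import all_boot all_order all_algebra all_field.
From mathcomp Require Import boolp constructive_ereal.

(** If the minimal polynomial [f] of the fundamental unit [e] is even, i.e.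
    [f(1) = 0] modulo 2, then [e |-> 1] defines a ring morphism from [Z[e]] to
    the field with two elements. The roots of unity are [1] and [-1], so every
    unit is [+- e ^ n] and is sent to [1]. Hence the coefficients of any
    integral linear relation between units have an even sum; apply this to the
    minimal polynomial of a unit and to a vanishing sum of units. *)

Set Implicit Arguments.
Unset Strict Implicit.
Unset Printing Implicit Defensive.

Import Order.TTheory GRing.Theory Num.Theory.
Local Open Scope ring_scope.

Lemma pchar_F2 : 2%N \in [pchar 'F_2].
Proof. exact: pchar_Fp. Qed.

Lemma natr_F2_eq0 n : (n%:R == 0 :> 'F_2) = ~~ odd n.
Proof. by rewrite -(dvdn_pcharf pchar_F2) dvdn2. Qed.

Lemma natr_absz_F2 (n : int) : (absz n)%:R = n%:~R :> 'F_2.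
Proof.
case: n => n //=; rewrite NegzE mulrNz -pmulrn.
by rewrite (oppr_pchar2 pchar_F2).
Qed.

(** Absolute values are invisible modulo 2, so the length has the parity of the sum of the
    coefficients, which is the value at 1. *)
Lemma poly_length_F2 (p : {poly int}) :
  (poly_length p)%:R = p.[1]%:~R :> 'F_2.
Proof.
rewrite horner_coef /poly_length natr_sum rmorph_sum /=.
by apply: eq_bigr => i _; rewrite natr_absz_F2 expr1n mulr1.
Qed.

Section NumberField.
Variable K : fieldExtType rat.
Implicit Types (x e u z : K) (f p : {poly int}).

Lemma intr_poly_over p : map_poly (intr : int -> K) p \is a polyOver 1%VS.
Proof.
apply/polyOverP=> i; rewrite coef_map /=.
by rewrite rpredMz // rpred1.
Qed.

Lemma intr_inj_K : injective (intr : int -> K).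
Proof.
move=> m n /eqP; rewrite -subr_eq0 -rmorphB /= -(rmorph_int (in_alg K)).
by rewrite fmorph_eq0 intr_eq0 subr_eq0 => /eqP.
Qed.

Lemma size_map_intr p : size (map_poly (intr : int -> K) p) = size p.
Proof. by rewrite size_map_inj_poly //; exact: intr_inj_K. Qed.

Lemma monic_int_minPoly f x :
  map_poly (intr : int -> K) f = minPoly 1%AS x -> f \is monic.
Proof.
move=> fE; rewrite monicE; apply/eqP/intr_inj_K.
have /monicP := monic_minPoly 1%AS x.
by rewrite -fE lead_coef_map_inj //; exact: intr_inj_K.
Qed.

(** As [f] is monic, division with remainder works over the integers. The remainder vanishes at [x]
    and is smaller than the minimal polynomial, hence is zero. *)
Lemma int_minPoly_dvd f p x :
    map_poly (intr : int -> K) f = minPoly 1%AS x ->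
    root (map_poly (intr : int -> K) p) x ->
  exists q, p = q * f.
Proof.
move=> fE px0; have fm := monic_int_minPoly fE.
exists (Pdiv.Ring.rdivp p f).
have pE := Pdiv.RingMonic.rdivp_eq fm p.
set r := Pdiv.Ring.rmodp p f in pE.
suff r0 : r = 0 by rewrite {1}pE r0 addr0.
have rx0 : root (map_poly (intr : int -> K) r) x.
  move: px0; rewrite {1}pE rmorphD rmorphM /= fE !rootE hornerD hornerM.
  by rewrite minPolyxx mulr0 add0r.
have dvd_r := minPoly_dvdp (intr_poly_over r) rx0.
apply: contraTeq (Pdiv.Ring.ltn_rmodpN0 p (monic_neq0 fm)) => r_neq0.
rewrite -leqNgt -(size_map_intr f) fE -(size_map_intr r).
by apply: dvdp_leq dvd_r; rewrite -size_poly_eq0 size_map_intr size_poly_eq0.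
Qed.

(** By Gauss's lemma, the rational minimal polynomial [q] is a rational multiple of an integer
    factor [p1] of the monic polynomial [p]. *)
Lemma int_minPoly_exists x : algebraic_integer x ->
  exists f, map_poly (intr : int -> K) f = minPoly 1%AS x.
Proof.
case=> p pm px0.
have /polyOver1P[q qE] := minPolyOver 1%AS x.
have ZQK (g : {poly int}) :
    map_poly (in_alg K) (map_poly (intr : int -> rat) g) =
    map_poly (intr : int -> K) g.
  rewrite -map_poly_comp; apply: eq_map_poly => n /=.
  by rewrite -(rmorph_int (in_alg K)).
have qm : q \is monic.
  by rewrite -(map_monic (in_alg K)) -qE monic_minPoly.
have : q %| map_poly (intr : int -> rat) p.
  by rewrite -(dvdp_map (in_alg K)) -qE ZQK minPoly_dvdp ?intr_poly_over.
case/dvdpP_rat_int => p1 [a a0 qE1] [r pE].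
have unit_lead : lead_coef p1 * lead_coef r = 1.
  by rewrite -lead_coefM -pE; apply/monicP.
have /orP lead_pm : (lead_coef p1 == 1) || (lead_coef p1 == -1).
  move/(congr1 absz)/eqP: unit_lead; rewrite abszM muln_eq1 => /andP[+ _].
  by case: (lead_coef p1) => -[|[|n]].
have a_lead : a * (lead_coef p1)%:~R = 1.
  move/monicP: qm; rewrite qE1 lead_coefZ lead_coef_map_inj //.
  exact: intr_inj.
(* Since [q] is monic, [a] is the inverse of the leading coefficient of [p1]; that coefficient is 1
   or -1, hence its own inverse. *)
exists (lead_coef p1 *: p1); rewrite qE qE1 -ZQK; congr map_poly.
rewrite linearZ /=; congr (_ *: _).
case: lead_pm a_lead => /eqP->; first by rewrite mulr1 => ->.
by rewrite rmorphN1 mulrN1 => /eqP; rewrite eqr_oppLR => /eqP.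
Qed.

(** This makes the morphism [e |-> 1] well defined modulo 2: [p] is a multiple of the minimal
    polynomial, whose value at 1 is even. *)
Lemma even_integer_root_F2 e p :
    even_integer e -> root (map_poly (intr : int -> K) p) e ->
  p.[1]%:~R = 0 :> 'F_2.
Proof.
case=> _ [f fE f_even] /(int_minPoly_dvd fE)[q ->].
move: f_even; rewrite -natr_F2_eq0 poly_length_F2 => /eqP f1.
by rewrite hornerM intrM f1 mulr0.
Qed.

(* Multiplying the relation by a large power of [e] makes all exponents
   nonnegative, so that [e^-1] need not be written as a polynomial in [e]. *)
Lemma even_integer_relation_F2 e (I : finType) (c : I -> int)
    (s : I -> bool) (n : I -> int) :
    e != 0 -> even_integer e ->
    \sum_i (c i)%:~R * ((-1) ^+ s i * e ^ n i) = 0 ->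
  \sum_i (c i)%:~R = 0 :> 'F_2.
Proof.
move=> e0 e_even rel.
pose N := (\sum_i absz (n i))%N.
have nN i : n i + N%:Z = absz (n i + N%:Z).
  rewrite gez0_abs // -lerBlDl sub0r.
  rewrite (le_trans (_ : - n i <= absz (n i))) //.
    by rewrite abszE -normrN ler_norm.
  by rewrite lez_nat /N (bigD1 i) //= leq_addr.
pose p : {poly int} := \sum_i (c i * (-1) ^+ s i) *: 'X^(absz (n i + N%:Z)).
have pe0 : root (map_poly (intr : int -> K) p) e.
  rewrite rootE /p rmorph_sum horner_sum /=.
  apply/eqP; rewrite -[RHS](mul0r (e ^ N)) -[in RHS]rel mulr_suml.
  apply: eq_bigr => i _.
  rewrite linearZ /= map_polyXn hornerZ hornerXn rmorphM rmorph_sign /=.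
  by rewrite -!mulrA -expfzDr // nN.
(* At 1 all monomials become 1, and modulo 2 the signs disappear. *)
rewrite -[RHS](even_integer_root_F2 e_even pe0) /p horner_sum rmorph_sum /=.
apply: eq_bigr => i _; rewrite hornerZ hornerXn expr1n mulr1 rmorphM.
rewrite rmorph_sign; case: (s i); rewrite ?mulr1 //=.
by rewrite mulrN1 (oppr_pchar2 pchar_F2).
Qed.

(** The image of [z] is a real number of absolute value 1, and embeddings are injective. *)
Lemma real_embedding_root_of_unity (sigma : {rmorphism K -> algC}) z :
  real_embedding sigma -> is_root_of_unity z -> z = 1 \/ z = -1.
Proof.
move=> real_s [m m_gt0 zm1].
have norm1 : `|sigma z| = 1.
  apply/eqP; rewrite -(pexpr_eq1 m_gt0) //.
  by rewrite -normrX -rmorphXn zm1 rmorph1 normr1.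
have /eqP := norm1; rewrite real_eqr_norml ?ler01 // andbT.
case/orP=> /eqP sz; [left|right]; apply: (fmorph_inj sigma).
  by rewrite sz rmorph1.
by rewrite sz rmorphN1.
Qed.

End NumberField.

Theorem theorem8 (K : fieldExtType rat)
    (hK : [\/ real_quadratic K, complex_cubic K |
              totally_complex_quartic K /\
              forall z : K, is_root_of_unity z -> z = 1 \/ z = -1])
    (hfund : exists e : K, fundamental_unit e /\ even_integer e) :
  (forall u : K, int_unit u -> even_integer u) /\ od K = +oo%E.
Proof.
have rootsP (z : K) : is_root_of_unity z -> z = 1 \/ z = -1.
  case: hK => [[_ [s rs]]|[_ [s rs _]]|[_]]; last exact.
    exact: real_embedding_root_of_unity rs.
  exact: real_embedding_root_of_unity rs.
case: hfund => e [[[_ [v _ ev1]] gen_e] e_even].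
have e0 : e != 0.
  by apply: contraTneq (oner_neq0 K) => e0; rewrite -ev1 e0 mul0r eqxx.
have unitP (u : K) : int_unit u -> exists sn : bool * int,
    u = (-1) ^+ sn.1 * e ^ sn.2.
  case/gen_e=> z [n [/rootsP[] -> ->]]; first by exists (false, n).
  by exists (true, n).
split=> [u u_unit|].
  have [f fE] := int_minPoly_exists u_unit.1.
  split; first exact: u_unit.1.
  exists f => //; rewrite -natr_F2_eq0 poly_length_F2.
  have [[s n] /= uE] := unitP u u_unit.
  apply/eqP; transitivity (\sum_(i < size f) (f`_i)%:~R : 'F_2).
    rewrite horner_coef rmorph_sum /=.
    by apply: eq_bigr => i _; rewrite expr1n mulr1.
  (* The relation is [f(u) = 0]. The sign of [u ^+ i] is negative exactly when that of [u] is and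
     [i] is odd. *)
  apply: (even_integer_relation_F2 (c := fun i : 'I_(size f) => f`_i)
           (s := fun i => s && odd i) (n := fun i => n * i%:Z) e0 e_even).
  have := minPolyxx 1%AS u; rewrite -fE horner_coef size_map_intr => fu0.
  rewrite -[RHS]fu0; apply: eq_bigr => i _; rewrite coef_map /= uE exprMn.
  congr (_ * (_ * _)); last by rewrite -exprz_exp.
  by case: (s) => /=; rewrite ?expr1n ?signr_odd.
rewrite /od; case: pselect => // od_ex; exfalso.
case: od_ex => k /and3P[k_odd _ /asboolP[u u_unit u0]].
have [sn snE] := choice (fun i => unitP (u i) (u_unit i)).
(* With all coefficients equal to 1, the relation forces [k] to be even. *)
have : \sum_(i < k) (1 : int)%:~R = 0 :> 'F_2.
  apply: (even_integer_relation_F2 (c := fun=> 1) (s := fun i => (sn i).1)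
           (n := fun i => (sn i).2) e0 e_even).
  by rewrite -[RHS]u0; apply: eq_bigr => i _; rewrite mul1r -snE.
by move/eqP; rewrite sumr_const card_ord natr_F2_eq0 k_odd.
Qed.
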